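(* Let $D\subset V$ be a free divisor with reduced equation $h$. For each $k$ with $0\le k\le\dim V$, the torsion submodule of $\Omega^k_D$ is equal to $$h\,\Omega^k(\log D)\big/\left(h\,\Omega^k_V+dh\wedge\Omega^{k-1}_V\right),$$ and thus $\check{\Omega}^k_D=\Omega^k_D/\mathrm{torsion}$.
   Context: $V$ is a complex manifold and $D\subset V$ a divisor with reduced (local) equation $h$. $D$ is free if the $\mathcal{O}_V$-module $\mathrm{Der}(\log D)$ of germs of vector fields $\chi$ with $\chi(h)\in(h)$ is locally free. $\Omega^k(\log D)$ is the $\mathcal{O}_V$-module of meromorphic $k$-forms $\omega$ on $V$ with $h\omega$ and $h\,d\omega$ regular. $\Omega^k_D=\Omega^k_V/(h\,\Omega^k_V+dh\wedge\Omega^{k-1}_V)$ is the module of Kähler $k$-forms on $D$, and $\check{\Omega}^k_D=\Omega^k_V/h\,\Omega^k(\log D)$. Torsion is with respect to non-zero-divisors of $\mathcal{O}_D$. *)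

(* Defs.v *)
From HB Require Import structures.
From mathcomp Require Import all_boot all_order all_algebra.
From mathcomp Require Import fraction generic_quotient ring_quotient.
From mathcomp Require Import complex.
From mathcomp Require Import freeg mpoly.
From mathcomp Require Import ring.
From mathcomp Require Import boolp classical_sets reals topology normedtype.

Set Implicit Arguments.
Unset Strict Implicit.
Unset Printing Implicit Defensive.

Import Order.TTheory GRing.Theory Num.Theory numFieldNormedType.Exports.

Local Open Scope ring_scope.

(* The ring C{x_1, ..., x_n} of convergent power series: [cps C n].  It models
   the local ring of a complex manifold at a point, in a chart, with the x_i
   being the coordinates of the chart centred at the point. *)

Section ConvergentPowerSeries.
Variables (C : numClosedFieldType) (n : nat).
Implicit Types (f g : 'X_{1..n} -> C) (m : 'X_{1..n}).

(* Absolute convergence on some polydisc; [0 < r] forces [r] to be real. *)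
Definition convergent f : Prop :=
  exists r M : C, 0 < r /\
    forall d, \sum_(m : 'X_{1..n < d}) `|f m| * r ^+ mdeg m <= M.

Record cps := CPS { cps_coef :> 'X_{1..n} -> C; _ : `[< convergent cps_coef >] }.

HB.instance Definition _ := [isSub for cps_coef].
HB.instance Definition _ := [Choice of cps by <:].

Lemma cpsP (u : cps) : convergent u.
Proof. by case: u => f /= /asboolP. Qed.

Definition mk_cps f (cf : convergent f) : cps := CPS (introT (asboolP _) cf).

Lemma cps_eqP (u v : cps) : (forall m, u m = v m) <-> u = v.
Proof. by split=> [uv|-> //]; apply/val_inj/funext. Qed.

Definition ps_mul f g m : C :=
  \sum_(k : 'X_{1..n < (mdeg m).+1, (mdeg m).+1} | m == (k.1 + k.2)%MM)
     f k.1 * g k.2.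

Definition ps_deriv (i : 'I_n) f m : C := (m i).+1%:R * f (m + U_(i))%MM.

Lemma convergent_le f g :
  convergent g -> (forall m, `|f m| <= `|g m|) -> convergent f.
Proof.
move=> [r [M [r0 H]]] fg; exists r, M; split=> // d.
apply: le_trans (H d); apply: ler_sum => m _.
by rewrite ler_wpM2r ?exprn_ge0 // ltW.
Qed.

Lemma convergent_common f g : convergent f -> convergent g ->
  exists r M : C, [/\ 0 < r,
    forall d, \sum_(m : 'X_{1..n < d}) `|f m| * r ^+ mdeg m <= M &
    forall d, \sum_(m : 'X_{1..n < d}) `|g m| * r ^+ mdeg m <= M].
Proof.
move=> [r1 [M1 [r10 H1]]] [r2 [M2 [r20 H2]]].
have M10 : 0 <= M1.
  by have := H1 0%N; apply/le_trans/sumr_ge0 => m _;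
     rewrite mulr_ge0 ?exprn_ge0 // ltW.
have M20 : 0 <= M2.
  by have := H2 0%N; apply/le_trans/sumr_ge0 => m _;
     rewrite mulr_ge0 ?exprn_ge0 // ltW.
have aux (h : 'X_{1..n} -> C) r r' M d : 0 < r -> r <= r' ->
    \sum_(m : 'X_{1..n < d}) `|h m| * r' ^+ mdeg m <= M ->
    \sum_(m : 'X_{1..n < d}) `|h m| * r ^+ mdeg m <= M.
  move=> r0 rr'; apply: le_trans; apply: ler_sum => m _.
  by rewrite ler_wpM2l // lerXn2r // nnegrE ltW // (lt_le_trans r0).
have /orP[r12|r21] : (r1 <= r2) || (r2 <= r1).
- by apply: real_leVge; rewrite gtr0_real.
- exists r1, (M1 + M2); split=> // d.
    by apply: le_trans (H1 d) _; rewrite lerDl.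
  by apply: le_trans (aux _ _ _ _ _ r10 r12 (H2 d)) _; rewrite lerDr.
- exists r2, (M1 + M2); split=> // d.
    by apply: le_trans (aux _ _ _ _ _ r20 r21 (H1 d)) _; rewrite lerDl.
  by apply: le_trans (H2 d) _; rewrite lerDr.
Qed.

Lemma convergentD f g :
  convergent f -> convergent g -> convergent (fun m => f m + g m).
Proof.
move=> cf cg; have [r [M [r0 Hf Hg]]] := convergent_common cf cg.
exists r, (M + M); split=> // d.
apply: le_trans (lerD (Hf d) (Hg d)); rewrite -big_split /=.
apply: ler_sum => m _; rewrite -mulrDl ler_wpM2r ?ler_normD //.
by rewrite exprn_ge0 // ltW.
Qed.

Lemma convergentN f : convergent f -> convergent (fun m => - f m).
Proof. by move=> cf; apply: convergent_le cf _ => m; rewrite normrN. Qed.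

Lemma convergent0 : convergent (fun=> 0).
Proof.
by exists 1, 0; split=> // d; rewrite big1 // => m _; rewrite normr0 mul0r.
Qed.

Lemma convergent1 : convergent (fun m => (m == 0%MM)%:R).
Proof.
exists 1, 1; split=> // d.
case: (posnP d) => [->|d0].
  by rewrite big_pred0 ?ler01 // => -[m] /=; rewrite ltn0.
have z0 : (mdeg (0%MM : 'X_{1..n}) < d)%N by rewrite mdeg0.
rewrite (bigD1 (BMultinom z0)) //= eqxx normr1 expr1n mulr1 big1 ?addr0 //.
by move=> m; rewrite bmeqP /= => /negbTE ->; rewrite normr0 mul0r.
Qed.

Definition ps_trunc d f : {mpoly C[n]} := \sum_(m : 'X_{1..n < d}) f m *: 'X_[m].

Lemma ps_mulE d f g m : (mdeg m < d)%N ->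
  ps_mul f g m = (ps_trunc d f * ps_trunc d g)@_m.
Proof.
move=> md; rewrite mcoeffM; apply: eq_bigr => k _.
have lt (k' : 'X_{1..n < (mdeg m).+1}) : (mdeg k' < d)%N.
  exact: leq_trans (bmdeg k') md.
by rewrite !mcoeff_mpoly.
Qed.

Lemma ps_mulEw d f g m : (mdeg m < d)%N ->
  ps_mul f g m = \sum_(k : 'X_{1..n < d, d} | m == (k.1 + k.2)%MM) f k.1 * g k.2.
Proof.
move=> md; rewrite (ps_mulE f g md) (mcoeff_poly_mul _ _ md).
by apply: eq_bigr => k _; rewrite !mcoeff_mpoly // bmdeg.
Qed.

Lemma convergentM f g : convergent f -> convergent g -> convergent (ps_mul f g).
Proof.
move=> cf cg; have [r [M [r0 Hf Hg]]] := convergent_common cf cg.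
exists r, (M * M); split=> // d.
pose F (k : 'X_{1..n < d, d}) :=
  (`|f k.1| * r ^+ mdeg k.1) * (`|g k.2| * r ^+ mdeg k.2).
have ge0 (h : 'X_{1..n} -> C) m : 0 <= `|h m| * r ^+ mdeg m.
  by rewrite mulr_ge0 // exprn_ge0 // ltW.
apply: (@le_trans _ _ (\sum_(k : 'X_{1..n < d, d}) F k)); last first.
  rewrite -(pair_big xpredT xpredT (fun k1 k2 : 'X_{1..n < d} =>
    (`|f k1| * r ^+ mdeg k1) * (`|g k2| * r ^+ mdeg k2))) /=.
  by rewrite -big_distrlr /= ler_pM ?Hf ?Hg // sumr_ge0.
apply: (@le_trans _ _ (\sum_(m : 'X_{1..n < d})
   \sum_(k : 'X_{1..n < d, d} | bmnm m == (k.1 + k.2)%MM) F k)).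
  apply: ler_sum => m _; rewrite (ps_mulEw f g (bmdeg m)).
  apply: le_trans (ler_wpM2r _ (ler_norm_sum _ _ _)) _.
    by rewrite exprn_ge0 // ltW.
  rewrite mulr_suml; apply: ler_sum => k /eqP ->.
  by rewrite mdegD exprD normrM /F mulrACA.
rewrite (exchange_big_dep xpredT) //=; apply: ler_sum => k _.
have Fk : 0 <= F k by rewrite mulr_ge0 // ge0.
case: (ltnP (mdeg (k.1 + k.2)%MM) d) => kd.
  by rewrite (big_pred1 (BMultinom kd)) // => m; rewrite /= bmeqP.
rewrite big_pred0 // => m; apply/negbTE/eqP => mk.
by move: kd; rewrite leqNgt -mk bmdeg.
Qed.

Lemma convergent_deriv i f : convergent f -> convergent (ps_deriv i f).
Proof.
move=> [r [M [r0 H]]]; exists (r / 2), (M / r); split=> [|d].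
  by rewrite divr_gt0.
have le2 (m : nat) : m.+1%:R <= 2 ^+ m :> C.
  by rewrite -natrX ler_nat ltn_expl.
apply: (@le_trans _ _ (r^-1 * \sum_(m : 'X_{1..n < d})
    `|f (m + U_(i))%MM| * r ^+ mdeg (m + U_(i))%MM)).
  rewrite mulr_sumr; apply: ler_sum => m _.
  rewrite /ps_deriv normrM normr_nat mdegD mdeg1 addn1 exprS.
  rewrite [leRHS](_ : _ = `|f (m + U_(i))%MM| * r ^+ mdeg m); last first.
    by rewrite mulrCA mulKf // gt_eqF.
  rewrite -mulrA mulrCA ler_wpM2l // expr_div_n mulrA.
  rewrite ler_pdivrMr ?exprn_gt0 // mulrC.
  rewrite ler_wpM2l ?exprn_ge0 ?(ltW r0) //.
  apply: le_trans (le2 _); rewrite ler_nat ltnS.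
  by rewrite mdegE (bigD1 i) //= leq_addr.
rewrite mulrC ler_pM2r ?invr_gt0 //; apply: le_trans (H d.+1).
have lt (m : 'X_{1..n < d}) : (mdeg (m + U_(i))%MM < d.+1)%N.
  by rewrite mdegD mdeg1 addn1 ltnS bmdeg.
pose s (m : 'X_{1..n < d}) := BMultinom (lt m).
have s_inj : injective s.
  move=> m1 m2 /(congr1 (@bmnm _ _)) /= /eqP; rewrite eqm_add2r => /eqP.
  exact: val_inj.
rewrite -(big_imset (fun m : 'X_{1..n < d.+1} => `|f m| * r ^+ mdeg m)
   (h := s) (A := predT)) /=; last by move=> x y _ _ /s_inj.
rewrite [leRHS](bigID (mem [set s x | x in predT]%SET)) /= lerDl.
by apply: sumr_ge0 => m _; rewrite mulr_ge0 // exprn_ge0 // ltW.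
Qed.


Definition cps0 : cps := mk_cps convergent0.
Definition cps1 : cps := mk_cps convergent1.
Definition cps_opp (u : cps) : cps := mk_cps (convergentN (cpsP u)).
Definition cps_add (u v : cps) : cps := mk_cps (convergentD (cpsP u) (cpsP v)).
Definition cps_mul (u v : cps) : cps := mk_cps (convergentM (cpsP u) (cpsP v)).

Fact cps_addA : associative cps_add.
Proof. by move=> u v w; apply/cps_eqP => m /=; rewrite addrA. Qed.
Fact cps_addC : commutative cps_add.
Proof. by move=> u v; apply/cps_eqP => m /=; rewrite addrC. Qed.
Fact cps_add0 : left_id cps0 cps_add.
Proof. by move=> u; apply/cps_eqP => m /=; rewrite add0r. Qed.
Fact cps_addN : left_inverse cps0 cps_opp cps_add.
Proof. by move=> u; apply/cps_eqP => m /=; rewrite addNr. Qed.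

HB.instance Definition _ :=
  GRing.isZmodule.Build cps cps_addA cps_addC cps_add0 cps_addN.

Lemma eq_mcoeffM (p p' q q' : {mpoly C[n]}) m :
  (forall k, (mdeg k <= mdeg m)%N -> p@_k = p'@_k /\ q@_k = q'@_k) ->
  (p * q)@_m = (p' * q')@_m.
Proof.
move=> E; rewrite !mcoeffM; apply: eq_bigr => k _.
have [-> _] : p@_k.1 = p'@_k.1 /\ q@_k.1 = q'@_k.1 by apply: E; exact: (bmdeg k.1).
by have [_ ->] : p@_k.2 = p'@_k.2 /\ q@_k.2 = q'@_k.2 by apply: E; exact: (bmdeg k.2).
Qed.

Fact cps_mulA : associative cps_mul.
Proof.
move=> u v w; apply/cps_eqP => m /=.
pose t (f : 'X_{1..n} -> C) := ps_trunc (mdeg m).+1 f.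
rewrite !(@ps_mulE (mdeg m).+1) //.
transitivity ((t u * (t v * t w))@_m).
  apply: eq_mcoeffM => k km; split=> //.
  by rewrite mcoeff_mpoly ?ltnS // (@ps_mulE (mdeg m).+1).
rewrite mulrA; apply: eq_mcoeffM => k km; split=> //.
by rewrite mcoeff_mpoly ?ltnS // (@ps_mulE (mdeg m).+1).
Qed.

Fact cps_mulC : commutative cps_mul.
Proof.
by move=> u v; apply/cps_eqP => m /=; rewrite !(@ps_mulE (mdeg m).+1) // mulrC.
Qed.

Fact cps_mul1 : left_id cps1 cps_mul.
Proof.
move=> u; apply/cps_eqP => m /=; rewrite (@ps_mulE (mdeg m).+1) //.
transitivity ((1 * ps_trunc (mdeg m).+1 u)@_m).
  by apply: eq_mcoeffM => k km; rewrite mcoeff_mpoly ?ltnS // mcoeff1.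
by rewrite mul1r mcoeff_mpoly.
Qed.

Fact cps_mulDl : left_distributive cps_mul cps_add.
Proof.
move=> u v w; apply/cps_eqP => m /=; rewrite !(@ps_mulE (mdeg m).+1) //.
rewrite -mcoeffD -mulrDl; apply: eq_mcoeffM => k km; split=> //.
by rewrite mcoeffD !mcoeff_mpoly.
Qed.

Fact cps_1neq0 : cps1 != 0 :> cps.
Proof.
apply/eqP => /(congr1 (fun u : cps => u 0%MM)) /=.
by rewrite eqxx => /eqP; rewrite oner_eq0.
Qed.

HB.instance Definition _ :=
  GRing.Zmodule_isComNzRing.Build cps cps_mulA cps_mulC cps_mul1 cps_mulDl
    cps_1neq0.

Definition cps_unit : pred cps := fun u => `[< exists v : cps, v * u = 1 >].
Definition cps_inv (u : cps) : cps :=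
  if pselect (exists v : cps, v * u = 1) is left e then projT1 (cid e) else u.

Fact cps_mulV : {in cps_unit, left_inverse 1 cps_inv *%R}.
Proof.
by move=> u /asboolP; rewrite /cps_inv; case: pselect => // e _; case: (cid e).
Qed.
Fact cps_unitP (u v : cps) : v * u = 1 -> cps_unit u.
Proof. by move=> e; apply/asboolP; exists v. Qed.
Fact cps_inv_out : {in [predC cps_unit], cps_inv =1 id}.
Proof.
by move=> u /asboolPn; rewrite /cps_inv; case: pselect.
Qed.

HB.instance Definition _ :=
  GRing.ComNzRing_hasMulInverse.Build cps cps_mulV cps_unitP cps_inv_out.

Lemma cps_lead (u : cps) : u != 0 ->
  exists2 m, u m != 0 & forall k, (k < m)%O -> u k = 0.
Proof.
move=> u0; have [m um] : exists m, u m != 0.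
  apply: contrapT => H; case/eqP: u0; apply/cps_eqP => m.
  by apply/eqP; apply: contrapT => /negP um; apply: H; exists m.
elim/(@ltmwf n): m um => m IH um.
have [[k km uk]|H] := pselect (exists2 k, (k < m)%O & u k != 0).
  exact: IH km uk.
exists m => // k km; apply/eqP; apply: contrapT => /negP uk.
by apply: H; exists k.
Qed.

Fact cps_integral (u v : cps) : u * v = 0 -> (u == 0) || (v == 0).
Proof.
move=> uv; apply/norP => -[/cps_lead [a ua Ha] /cps_lead [b vb Hb]].
have /eqP : (u * v) (a + b)%MM = 0 by rewrite uv.
have ak : (mdeg a < (mdeg (a + b)%MM).+1)%N by rewrite ltnS mdegD leq_addr.
have bk : (mdeg b < (mdeg (a + b)%MM).+1)%N by rewrite ltnS mdegD leq_addl.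
rewrite [_ (a + b)%MM](_ : _ = u a * v b) ?mulf_eq0 ?(negbTE ua) ?(negbTE vb) //.
rewrite [LHS]/= /ps_mul (bigD1 (BMultinom ak, BMultinom bk)) //= big1 ?addr0 //.
move=> [k1 k2] /= /andP[/eqP e ne].
have [lt|gt|eq1] := ltgtP (bmnm k1) a; first by rewrite Ha ?mul0r.
  have [lt2|gt2|eq2] := ltgtP (bmnm k2) b; first by rewrite Hb ?mulr0.
    by have := ltm_add gt gt2; rewrite -e ltxx.
  have le2 : (b <= bmnm k2)%O by rewrite eq2.
  by have := ltmc_le_add gt le2; rewrite -e ltxx.
move: e; rewrite eq1 => /eqP; rewrite eqm_add2l => /eqP eq2.
by case/eqP: ne; congr pair; apply: val_inj.
Qed.

HB.instance Definition _ := GRing.ComUnitRing_isIntegral.Build cps cps_integral.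

Definition cps_deriv (i : 'I_n) (u : cps) : cps :=
  mk_cps (convergent_deriv i (cpsP u)).

Fact cps_derivB i : {morph cps_deriv i : u v / u - v}.
Proof.
by move=> u v; apply/cps_eqP => m; rewrite /= /ps_deriv /= mulrBr.
Qed.

Fact cps_derivM i u v :
  cps_deriv i (u * v) = cps_deriv i u * v + u * cps_deriv i v.
Proof.
apply/cps_eqP => m; pose d := (mdeg m).+2.
pose t (w : 'X_{1..n} -> C) := ps_trunc d w.
have dE (w : 'X_{1..n} -> C) k : (mdeg k <= mdeg m)%N ->
    (t (ps_deriv i w))@_k = ((t w)^`M(i))@_k.
  move=> km; rewrite mcoeff_deriv !mcoeff_mpoly.
  - by rewrite /ps_deriv mulr_natl.
  - by rewrite mdegD mdeg1 addn1 !ltnS.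
  - by rewrite !ltnS (leq_trans km).
transitivity ((t (ps_mul u v))^`M(i)@_m).
  by rewrite -dE // mcoeff_mpoly ?ltnS.
transitivity ((t u * t v)^`M(i)@_m).
  rewrite !mcoeff_deriv mcoeff_mpoly; last by rewrite mdegD mdeg1 addn1.
  by rewrite (@ps_mulE d) // mdegD mdeg1 addn1.
rewrite mderivM mcoeffD /= !(@ps_mulE d) ?ltnS //; congr (_ + _);
  by apply: eq_mcoeffM => k km; rewrite dE.
Qed.

End ConvergentPowerSeries.

Section FieldIdentities.
Variables (K : fieldType) (p q r s p' q' r' s' : K).
Hypotheses (q0 : q != 0) (s0 : s != 0).

Lemma sub_fracE : p / q - r / s = (p * s - r * q) / (q * s).
Proof. by field; rewrite q0 s0. Qed.

Lemma quot_ruleB :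
  ((p' * s + p * s' - (r' * q + r * q')) * (q * s)
     - (p * s - r * q) * (q' * s + q * s')) / (q * s) ^+ 2
  = (p' * q - p * q') / q ^+ 2 - (r' * s - r * s') / s ^+ 2.
Proof. by field; rewrite q0 s0. Qed.

Lemma quot_ruleM :
  ((p' * r + p * r') * (q * s) - (p * r) * (q' * s + q * s')) / (q * s) ^+ 2
  = (p' * q - p * q') / q ^+ 2 * (r / s)
    + p / q * ((r' * s - r * s') / s ^+ 2).
Proof. by field; rewrite q0 s0. Qed.

End FieldIdentities.

Section FractionDerivation.
Variables (A : idomainType) (D : A -> A).

Definition frac_deriv (x : {fraction A}) : {fraction A} :=
  let p := \n_(repr x) in let q := \d_(repr x) in
  FracField.tofrac (D p * q - p * D q) / FracField.tofrac q ^+ 2.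

Hypothesis DB : {morph D : u v / u - v}.
Hypothesis DM : forall u v, D (u * v) = D u * v + u * D v.

Local Notation F := FracField.tofrac.

Lemma frac_reprE (x : {fraction A}) : x = F \n_(repr x) / F \d_(repr x).
Proof.
have q0 : F \d_(repr x) != 0 by rewrite tofrac_eq0 denom_ratioP.
apply: (mulIf q0); rewrite divfK // -{1}[x]reprK.
move: (repr x) => r {q0 x}.
unlock FracField.tofrac; rewrite -[LHS]FracField.pi_mul.
apply/eqmodP; rewrite /= FracField.equivfE /FracField.mulf.
rewrite !numden_Ratio ?mulf_neq0 ?oner_eq0 ?denom_ratioP //.
by rewrite !mulr1 mulrC.
Qed.

Lemma frac_derivE p q : q != 0 ->
  frac_deriv (F p / F q) = F (D p * q - p * D q) / F q ^+ 2.
Proof.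
move=> q0; rewrite /frac_deriv; set x := F p / F q.
have r0 := denom_ratioP (repr x).
have /eqP := frac_reprE x.
rewrite {1}/x eqr_div ?tofrac_eq0 // -!tofracM tofrac_eq => /eqP.
move: (\n_(repr x)) (\d_(repr x)) r0 => r1 r2 r0 e.
apply/eqP; rewrite eqr_div ?expf_neq0 ?tofrac_eq0 //.
rewrite -!tofracXn -!tofracM tofrac_eq.
have e' : D p * r2 + p * D r2 = D r1 * q + r1 * D q by rewrite -!DM e.
apply/eqP.
transitivity ((D r1 * q + r1 * D q - r1 * D q) * r2 * q - r1 * q * D r2 * q).
  by ring.
rewrite -e' -e.
transitivity (D p * r2 * r2 * q - (r1 * q) * D q * r2); first by ring.
by rewrite -e; ring.
Qed.

Lemma frac_deriv_tofrac u : frac_deriv (F u) = F (D u).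
Proof.
have D1 : D 1 = 0.
  by apply: (addrI (D 1)); rewrite addr0 -{3}[1]mulr1 DM mulr1 mul1r.
have := @frac_derivE u 1 (oner_neq0 _).
by rewrite tofrac1 D1 divr1 expr1n divr1 mulr1 mulr0 subr0.
Qed.

Lemma frac_derivB : {morph frac_deriv : x y / x - y}.
Proof.
move=> x y; rewrite [x]frac_reprE [y]frac_reprE.
have : \d_(repr x) != 0 by exact: denom_ratioP.
have : \d_(repr y) != 0 by exact: denom_ratioP.
move: (\n_(repr x)) (\d_(repr x)) (\n_(repr y)) (\d_(repr y)) => p q r s s0 q0.
have Fq : F q != 0 by rewrite tofrac_eq0.
have Fs : F s != 0 by rewrite tofrac_eq0.
rewrite (sub_fracE _ _ Fq Fs) -!tofracM -tofracB !frac_derivE ?mulf_neq0 //.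
by rewrite DB !DM !(tofracB, tofracM, tofracD) (quot_ruleB _ _ _ _ _ _ Fq Fs).
Qed.

Lemma frac_derivM x y :
  frac_deriv (x * y) = frac_deriv x * y + x * frac_deriv y.
Proof.
rewrite [x]frac_reprE [y]frac_reprE.
have : \d_(repr x) != 0 by exact: denom_ratioP.
have : \d_(repr y) != 0 by exact: denom_ratioP.
move: (\n_(repr x)) (\d_(repr x)) (\n_(repr y)) (\d_(repr y)) => p q r s s0 q0.
have Fq : F q != 0 by rewrite tofrac_eq0.
have Fs : F s != 0 by rewrite tofrac_eq0.
rewrite mulf_div -!tofracM !frac_derivE ?mulf_neq0 //.
by rewrite !DM !(tofracB, tofracM, tofracD) (quot_ruleM _ _ _ _ _ _ Fq Fs).
Qed.

End FractionDerivation.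

Section QuotientModule.
Variables (A : pzRingType) (M : lmodType A) (N : submodClosed M).

(* [submodClosed] does not record closure under opposites, which [Quotient.quot]
   requires. *)
Definition submod_pred : {pred M} := fun x => x \in N.

Fact submod_pred_zmod : zmod_closed submod_pred.
Proof.
split=> [|x y]; rewrite ?rpred0 // /submod_pred => xN yN.
by rewrite unfold_in -scaleN1r rpredD // rpredZ.
Qed.

HB.instance Definition _ := GRing.isZmodClosed.Build M submod_pred submod_pred_zmod.

Definition quotmod : Type := Quotient.quot submod_pred.

HB.instance Definition _ := GRing.Zmodule.on quotmod.

Definition quotproj (x : M) : quotmod := \pi_(Quotient.quot submod_pred)%qT x.

Lemma quotproj_eq x y : (quotproj x = quotproj y) <-> (x - y \in N).
Proof.
rewrite -[_ \in N]/(x - y \in submod_pred) Quotient.idealrBE.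
by split=> [/eqP|/eqP].
Qed.

Lemma quotprojD : {morph quotproj : x y / x + y}.
Proof. exact: (raddfD \pi_(Quotient.quot submod_pred)%qT). Qed.

Lemma quotprojK (x : quotmod) : quotproj (repr (x : Quotient.quot submod_pred)) = x.
Proof. exact: reprK. Qed.

Definition quot_scale (a : A) (x : quotmod) : quotmod :=
  quotproj (a *: repr (x : Quotient.quot submod_pred)).

Lemma quot_scaleE a x : quot_scale a (quotproj x) = quotproj (a *: x).
Proof.
apply/quotproj_eq; rewrite -scalerBr rpredZ //; apply/quotproj_eq.
exact: quotprojK.
Qed.

Fact quot_scaleA a b x : quot_scale a (quot_scale b x) = quot_scale (a * b) x.
Proof. by rewrite -[x]quotprojK !quot_scaleE scalerA. Qed.
Fact quot_scale1 : left_id 1 quot_scale.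
Proof. by move=> x; rewrite -[x]quotprojK !quot_scaleE scale1r. Qed.
Fact quot_scaleDr : right_distributive quot_scale +%R.
Proof.
move=> a x y; rewrite -[x]quotprojK -[y]quotprojK -quotprojD !quot_scaleE.
by rewrite scalerDr quotprojD.
Qed.
Fact quot_scaleDl x : {morph quot_scale^~ x : a b / a + b}.
Proof.
by move=> a b; rewrite -[x]quotprojK !quot_scaleE scalerDl quotprojD.
Qed.

HB.instance Definition _ := GRing.Zmodule_isLmodule.Build A quotmod
  quot_scaleA quot_scale1 quot_scaleDr quot_scaleDl.

Fact quotproj_linear : linear quotproj.
Proof. by move=> a x y; rewrite quotprojD -quot_scaleE. Qed.

HB.instance Definition _ :=
  GRing.isLinear.Build A M quotmod _ quotproj quotproj_linear.

End QuotientModule.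

(* A k-form is written in the basis dx_I = dx_{i_1} /\ ... /\ dx_{i_k}, where
   I = {i_1 < ... < i_k} ranges over the k-element subsets of {0, ..., n-1}. *)

Definition kindex (n k : nat) : predArgType := {I : {set 'I_n} | #|I| == k}.
HB.instance Definition _ n k := Finite.on (kindex n k).
HB.instance Definition _ n k := SubType.on (kindex n k).

Notation kform A n k := {ffun kindex n k -> A^o}.

Section Forms.
Variables (A : comNzRingType) (n : nat).

Definition form_coef k (w : kform A n k) (J : {set 'I_n}) : A :=
  if insub J is Some s then w s else 0.

(* dx_i /\ dx_I = wedge_sign i J dx_J, if i is not in I and J is I plus i *)
Definition wedge_sign (i : 'I_n) (J : {set 'I_n}) : A :=
  (-1) ^+ #|[pred j in J | (j < i)%N]|.

(* (\sum_i a_i dx_i) /\ w *)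
Definition wedge1 k (a : 'I_n -> A) (w : kform A n k) : kform A n k.+1 :=
  [ffun J : kindex n k.+1 => \sum_(i in val J)
     wedge_sign i (val J) * (a i * form_coef w (val J :\ i))].

(* \sum_i dx_i /\ D_i w, where D_i acts on the coefficients of w *)
Definition ext_deriv (D : 'I_n -> A -> A) k (w : kform A n k) : kform A n k.+1 :=
  [ffun J : kindex n k.+1 => \sum_(i in val J)
     wedge_sign i (val J) * D i (form_coef w (val J :\ i))].

Lemma form_coefD k (v w : kform A n k) J :
  form_coef (v + w) J = form_coef v J + form_coef w J.
Proof. by rewrite /form_coef; case: insubP => [I _ _|_]; rewrite ?ffunE ?addr0. Qed.

Lemma form_coefZ k a (w : kform A n k) J :
  form_coef (a *: w) J = a * form_coef w J.
Proof. by rewrite /form_coef; case: insubP => [I _ _|_]; rewrite ?ffunE ?mulr0. Qed.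

Lemma wedge1D k a (v w : kform A n k) : wedge1 a (v + w) = wedge1 a v + wedge1 a w.
Proof.
apply/ffunP => J; rewrite !ffunE -big_split; apply: eq_bigr => i _ /=.
by rewrite form_coefD !mulrDr.
Qed.

Lemma wedge1Z k a b (w : kform A n k) : wedge1 a (b *: w) = b *: wedge1 a w.
Proof.
apply/ffunP => J; rewrite !ffunE /GRing.scale /= mulr_sumr.
apply: eq_bigr => i _; rewrite form_coefZ; ring.
Qed.

Lemma ext_derivD D k (v w : kform A n k) :
  (forall i, {morph D i : x y / x + y}) ->
  ext_deriv D (v + w) = ext_deriv D v + ext_deriv D w.
Proof.
move=> DD; apply/ffunP => J; rewrite !ffunE -big_split; apply: eq_bigr => i _ /=.
by rewrite form_coefD DD mulrDr.
Qed.

Lemma ext_derivZ D k b (w : kform A n k) :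
  (forall i x y, D i (x * y) = D i x * y + x * D i y) ->
  ext_deriv D (b *: w) = wedge1 (D^~ b) w + b *: ext_deriv D w.
Proof.
move=> DM; apply/ffunP => J; rewrite !ffunE /GRing.scale /= mulr_sumr -big_split.
apply: eq_bigr => i _; rewrite form_coefZ DM /=; ring.
Qed.

Lemma scale_leibniz k (b c : A) a (v : kform A n k) (dv dw : kform A n k.+1) :
  b *: (wedge1 a v + c *: dv + dw) = wedge1 a (b *: v) + c *: (b *: dv) + b *: dw.
Proof. by rewrite !scalerDr wedge1Z !scalerA [c * b]mulrC. Qed.

End Forms.

Section LogarithmicForms.
Variables (C : numClosedFieldType) (n : nat).
Local Notation O := (cps C n).
Local Notation K := {fraction O}.
Local Notation F := (@FracField.tofrac O).
Implicit Types (h g : O) (k : nat).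

Definition dfun h : 'I_n -> O := fun i => cps_deriv i h.

(* Meromorphic germs of forms have coefficients in the fraction field of O. *)
Definition mero k (a : kform O n k) : kform K n k := [ffun I => F (a I)].

Definition regular_form k (w : kform K n k) : Prop := exists a, w = mero a.

Definition mero_d k (w : kform K n k) : kform K n k.+1 :=
  ext_deriv (fun i => frac_deriv (@cps_deriv C n i)) w.

Definition log_form h k (w : kform K n k) : Prop :=
  regular_form (F h *: w) /\ regular_form (F h *: mero_d w).

(* h Omega^k(log D), as a subset of Omega^k_V *)
Definition hlog_forms h k : {pred kform O n k} :=
  fun a => `[< exists2 w, log_form h w & mero a = F h *: w >].
Arguments hlog_forms : clear implicits.

(* dh /\ Omega^{k-1}_V, with Omega^{-1}_V = 0 *)
Definition dh_wedge h k : kform O n k -> Prop :=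
  match k with
  | 0 => fun a => a = 0
  | j.+1 => fun a => exists b : kform O n j, a = wedge1 (dfun h) b
  end.

(* h Omega^k_V + dh /\ Omega^{k-1}_V *)
Definition kahler_rel h k : {pred kform O n k} :=
  fun a => `[< exists b c, dh_wedge h c /\ a = h *: b + c >].
Arguments kahler_rel : clear implicits.

Definition principal_ideal h : {pred O^o} := fun a => `[< exists b, a = b * h >].

Fact frac_cps_derivD i :
  {morph frac_deriv (@cps_deriv C n i) : x y / x + y}.
Proof.
have B := frac_derivB (@cps_derivB C n i) (@cps_derivM C n i).
have D0 : frac_deriv (@cps_deriv C n i) 0 = 0.
  by have := B 0 0; rewrite !subrr.
by move=> x y; rewrite -{1}[y]opprK B -{1}[- y]sub0r B D0 sub0r opprK.
Qed.

Fact frac_cps_derivM i x y :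
  frac_deriv (@cps_deriv C n i) (x * y) =
  frac_deriv (@cps_deriv C n i) x * y + x * frac_deriv (@cps_deriv C n i) y.
Proof. exact: (frac_derivM (@cps_derivM C n i)). Qed.

Lemma meroD k (a b : kform O n k) : mero (a + b) = mero a + mero b.
Proof. by apply/ffunP => I; rewrite !ffunE tofracD. Qed.

Lemma meroZ k g (a : kform O n k) : mero (g *: a) = F g *: mero a.
Proof. by apply/ffunP => I; rewrite !ffunE tofracM. Qed.

Lemma mero0 k : mero (0 : kform O n k) = 0.
Proof. by apply/ffunP => I; rewrite !ffunE tofrac0. Qed.

Lemma mero_wedge1 k (a : 'I_n -> O) (b : kform O n k) :
  mero (wedge1 a b) = wedge1 (fun i => F (a i)) (mero b).
Proof.
apply/ffunP => J; rewrite !ffunE rmorph_sum; apply: eq_bigr => i _ /=.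
rewrite !tofracM rmorphXn rmorphN1 /form_coef; congr (_ * (_ * _)).
by case: insubP => [I _ _|_]; rewrite ?ffunE // tofrac0.
Qed.

Fact hlog_forms_closed h k : GRing.submod_closed (hlog_forms h k).
Proof.
split=> [|g a b /asboolP[v [[v1 hv] [v2 hdv]] av] /asboolP[w [[w1 hw] [w2 hdw]] bw]].
  have d0 : mero_d (0 : kform K n k) = 0.
    rewrite -[in LHS](scale0r (0 : kform K n k)) /mero_d.
    rewrite (ext_derivZ _ _ frac_cps_derivM) scale0r addr0.
    apply/ffunP => J; rewrite !ffunE big1 // => i _.
    by rewrite /form_coef; case: insubP => [I _ _|_]; rewrite ?ffunE !mulr0.
  apply/asboolP; exists 0; last by rewrite mero0 scaler0.
  by split; exists 0; rewrite mero0 ?d0 scaler0.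
apply/asboolP; exists (F g *: v + w); last first.
  by rewrite meroD meroZ av bw scalerDr !scalerA mulrC.
split.
  exists (g *: v1 + w1); rewrite meroD meroZ -hv -hw scalerDr !scalerA.
  by rewrite [F g * _]mulrC.
exists (wedge1 (dfun g) v1 + g *: v2 + w2).
rewrite /mero_d (ext_derivD _ _ frac_cps_derivD) (ext_derivZ _ _ frac_cps_derivM).
rewrite scale_leibniz 2!meroD meroZ mero_wedge1 -hv -hdv -hdw.
congr (wedge1 _ _ + _ + _); apply/funext => i.
by rewrite (frac_deriv_tofrac (@cps_derivM C n i)).
Qed.

Fact kahler_rel_closed h k : GRing.submod_closed (kahler_rel h k).
Proof.
have cl0 : dh_wedge h (0 : kform O n k).
  case: k => //= k; exists 0; rewrite -[in RHS](scale0r 0) wedge1Z.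
  by rewrite scale0r.
have cl g (a b : kform O n k) : dh_wedge h a -> dh_wedge h b ->
    dh_wedge h (g *: a + b).
  case: k a b {cl0} => [|k] a b /= => [-> ->|[a' ->] [b' ->]].
    by rewrite scaler0 addr0.
  by exists (g *: a' + b'); rewrite wedge1D wedge1Z.
split=> [|g a b].
  by apply/asboolP; exists 0, 0; split=> //; rewrite scaler0 addr0.
move=> /asboolP[a1 [a2 [Ha ->]]] /asboolP[b1 [b2 [Hb ->]]]; apply/asboolP.
exists (g *: a1 + b1), (g *: a2 + b2); split; first exact: cl.
by rewrite !scalerDr !scalerA [h * g]mulrC addrACA.
Qed.

Fact principal_ideal_closed h : GRing.submod_closed (principal_ideal h).
Proof.
split=> [|g a b /asboolP[a' ->] /asboolP[b' ->]]; apply/asboolP.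
  by exists 0; rewrite mul0r.
by exists (g * a' + b'); rewrite mulrDl -mulrA.
Qed.

HB.instance Definition _ h k :=
  GRing.isSubmodClosed.Build O _ (hlog_forms h k) (hlog_forms_closed h k).
HB.instance Definition _ h k :=
  GRing.isSubmodClosed.Build O _ (kahler_rel h k) (kahler_rel_closed h k).
HB.instance Definition _ h :=
  GRing.isSubmodClosed.Build O _ (principal_ideal h) (principal_ideal_closed h).

(* The local ring of D, as an O-module; it is the zero ring outside D. *)
Definition O_D h := quotmod (principal_ideal h).

(* The class of g in O_D is not a zero divisor. *)
Definition nonzerodivisor h g : Prop := forall y : O_D h, g *: y = 0 -> y = 0.

Definition torsion h (M : lmodType O) : {pred M} :=
  fun x => `[< exists2 g, nonzerodivisor h g & g *: x = 0 >].
Arguments torsion : clear implicits.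

Fact torsion_closed h M : GRing.submod_closed (torsion h M).
Proof.
split=> [|a x y /asboolP[g1 H1 e1] /asboolP[g2 H2 e2]]; apply/asboolP.
  by exists 1; [move=> y; rewrite scale1r | rewrite scaler0].
exists (g1 * g2); first by move=> z; rewrite -scalerA => /H1 /H2.
rewrite scalerDr -[X in _ + X]scalerA e2 scaler0 addr0.
by rewrite scalerA -mulrA mulrC -scalerA e1 scaler0.
Qed.

HB.instance Definition _ h M :=
  GRing.isSubmodClosed.Build O M (torsion h M) (torsion_closed h M).

Definition Omega_D h k := quotmod (kahler_rel h k).
Definition Omega_check h k := quotmod (hlog_forms h k).

End LogarithmicForms.
Arguments hlog_forms {C n} h k _.
Arguments kahler_rel {C n} h k _.
Arguments torsion {C n} h M _.

Section LogarithmicDerivations.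
Variables (C : numClosedFieldType) (n : nat).
Local Notation O := (cps C n).

(* The vector field \sum_i chi_i d/dx_i belongs to Der(log D). *)
Definition Der_log (h : O) (chi : 'rV[O]_n) : Prop :=
  \sum_i chi 0 i * cps_deriv i h \in principal_ideal h.

Definition is_basis_of (N : 'rV[O]_n -> Prop) r (b : 'I_r -> 'rV[O]_n) : Prop :=
  (forall j, N (b j)) /\
  forall chi, N chi -> exists! a : {ffun 'I_r -> O}, chi = \sum_j a j *: b j.

(* h is a reduced equation at a point: it is not zero and O / (h) has no
   nilpotent elements other than 0. *)
Definition reduced_germ (h : O) : Prop :=
  h != 0 /\
  forall (u : O) m, u ^+ m \in principal_ideal h -> u \in principal_ideal h.

End LogarithmicDerivations.

Section Holomorphic.
Variables (C : numClosedFieldType) (n : nat).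
Implicit Types (f : 'rV[C]_n -> C) (a : 'rV[C]_n).

(* f is the sum of the power series u in the coordinates centred at a, on some
   polydisc. *)
Definition taylor_at f a (u : cps C n) : Prop :=
  exists2 r : C, 0 < r & forall z : 'rV[C]_n, (forall i, `|z 0 i - a 0 i| < r) ->
    ((fun d => \sum_(m : 'X_{1..n < d}) u m * \prod_i (z 0 i - a 0 i) ^+ m i)
      @ \oo --> f z)%classic.

Definition holomorphic_at f a : Prop := exists u, taylor_at f a u.

Definition germ f a : cps C n := xget 0 [set u | taylor_at f a u]%classic.

End Holomorphic.

Section ComplexManifolds.
Variables (R : realType) (n : nat).
Local Notation C := (R[i] : numClosedFieldType).

Record chart (V : topologicalType) := Chart {
  chart_dom : set V;
  chart_coords :> V -> 'rV[C]_n;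
  chart_inv : 'rV[C]_n -> V;
  chart_dom_open : open chart_dom;
  chart_codom_open : open (chart_coords @` chart_dom)%classic;
  chart_coordsK : {in chart_dom, cancel chart_coords chart_inv};
  chart_coords_continuous : {within chart_dom, continuous chart_coords}%classic;
  chart_inv_continuous : {within chart_coords @` chart_dom, continuous chart_inv}%classic
}.

Record complex_manifold := ComplexManifold {
  manifold_space :> topologicalType;
  space_hausdorff : hausdorff_space manifold_space;
  space_second_countable : @second_countable manifold_space;
  atlas : set (chart manifold_space);
  atlas_cover : forall x : manifold_space, exists2 phi, atlas phi & chart_dom phi x;
  atlas_compatible : forall phi psi, atlas phi -> atlas psi ->
    forall x, chart_dom phi x -> chart_dom psi x ->
    forall i, holomorphic_at (fun z => psi (chart_inv phi z) 0 i) (phi x)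
}.

Section Divisors.
Variable V : complex_manifold.
Implicit Types (D U : set V) (h : V -> C) (x : V) (phi : chart V).

Definition in_chart phi h : 'rV[C]_n -> C := fun z => h (chart_inv phi z).

(* The germ of h at x, in the local ring of V at x as seen in the chart phi. *)
Definition germ_in phi h x : cps C n := germ (in_chart phi h) (phi x).

Definition chart_at phi x : Prop := atlas phi /\ chart_dom phi x.

Definition holomorphic_on U h : Prop :=
  forall x, U x -> forall phi, chart_at phi x -> holomorphic_at (in_chart phi h) (phi x).

(* h is a reduced equation, on the open set U, of the divisor D, which is
   given by its support. *)
Definition reduced_equation D U h : Prop :=
  [/\ open U, holomorphic_on U h,
      forall x, U x -> (D x <-> h x = 0) &
      forall x, U x -> forall phi, chart_at phi x -> reduced_germ (germ_in phi h x)].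

Definition is_divisor D : Prop :=
  forall x, exists U h, U x /\ reduced_equation D U h.

(* Der(log D) is a locally free sheaf: it has a basis of sections delta_j over
   some open neighbourhood U of each point; their coordinates are those of the
   basis d/dz_i given by the chart phi. *)
Definition is_free D : Prop :=
  forall x, exists U h phi,
    [/\ U x, reduced_equation D U h, (forall y, U y -> chart_at phi y) &
    exists r (delta : 'I_r -> 'I_n -> V -> C),
      (forall j i, holomorphic_on U (delta j i)) /\
      forall y, U y -> is_basis_of (Der_log (germ_in phi h y))
        (fun j => \row_i germ_in phi (delta j i) y)].

Definition free_divisor D : Prop := is_divisor D /\ is_free D.

End Divisors.

End ComplexManifolds.

(* Main.v *)
(* Write [D] for a derivation [\sum_i c_i d/dx_i] with constant coefficients.  A
   form [a] lies in [h Omega^k(log D)] if and only if [h] divides [dh /\ a].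
   Contracting [dh /\ a] with [d/dx_i] then shows that every [dh/dx_i * a], hence
   [(D h) a], lies in [h Omega^k + dh /\ Omega^(k-1)].  Moreover [D h] is a
   non-zero-divisor modulo [h] for a suitable [c]: if [h] divides [u * D h], then,
   [h] being reduced, the ideal quotient [(h : u)] is stable under [D]; it contains
   [h], hence all [D^d h], and [D^d h] is a unit if [h] has a non-zero term of
   degree [d] on the line directed by [c].  So [h Omega^k(log D)] is torsion modulo
   [h Omega^k + dh /\ Omega^(k-1)].  Conversely, if [g a] lies in this module with
   [g] a non-zero-divisor, then [h] divides [g dh /\ a], hence [dh /\ a]. *)

Require Import Defs.
From HB Require Import structures.
From mathcomp Require Import all_boot all_order all_algebra complex.
From mathcomp Require Import fraction generic_quotient mpoly ring.
From mathcomp Require Import boolp classical_sets reals topology normedtype.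

Set Implicit Arguments.
Unset Strict Implicit.
Unset Printing Implicit Defensive.

Import Order.TTheory GRing.Theory Num.Theory.

Local Open Scope ring_scope.

(** * Contraction of forms with coordinate vector fields *)

Section Contraction.
Variables (A : comNzRingType) (n : nat).
Implicit Types (a : 'I_n -> A) (i l : 'I_n) (J : {set 'I_n}).

Lemma form_coef_val k (w : kform A n k) (J : kindex n k) :
  form_coef w (val J) = w J.
Proof. by rewrite /form_coef valK. Qed.

Lemma form_coef_out k (w : kform A n k) J : #|J| != k -> form_coef w J = 0.
Proof. by move=> Jk; rewrite /form_coef insubN. Qed.

(** Interior product with [d/dx_i]. If [i] lies in [I], then [i |: I] has only [k] elements and
    [form_coef] returns its default 0, as it should. *)
Definition contract i k (w : kform A n k.+1) : kform A n k :=
  [ffun I : kindex n k =>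
     wedge_sign A i (i |: val I) * form_coef w (i |: val I)].

Lemma form_coef_contract i k (w : kform A n k.+1) J : i \notin J ->
  form_coef (contract i w) J = wedge_sign A i (i |: J) * form_coef w (i |: J).
Proof.
move=> iJ; have [Jk|Jk] := boolP (#|J| == k).
  by rewrite -[J]/(val (Sub J Jk : kindex n k)) form_coef_val ffunE.
by rewrite !form_coef_out ?mulr0 // finset.cardsU1 iJ.
Qed.

Lemma form_coef_contract0 i k (w : kform A n k.+1) J : i \in J ->
  form_coef (contract i w) J = 0.
Proof.
move=> iJ; have [Jk|/form_coef_out-> //] := boolP (#|J| == k).
rewrite -[J]/(val (Sub J Jk : kindex n k)) form_coef_val ffunE /=.
rewrite form_coef_out ?mulr0 // (finset.setUidPr _) ?finset.sub1set //.
by rewrite (eqP Jk) neq_ltn ltnSn.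
Qed.

Lemma form_coef_wedge1 k a (w : kform A n k) J :
  form_coef (wedge1 a w) J =
  \sum_(l in J) wedge_sign A l J * (a l * form_coef w (J :\ l)).
Proof.
have [Jk|Jk] := boolP (#|J| == k.+1).
  by rewrite -[J]/(val (Sub J Jk : kindex n k.+1)) form_coef_val ffunE.
rewrite form_coef_out // big1 // => l lJ.
by rewrite form_coef_out ?mulr0 //; move: Jk; rewrite (finset.cardsD1 l) lJ.
Qed.

Lemma wedge_signK i J : wedge_sign A i J * wedge_sign A i J = 1.
Proof. by rewrite -expr2 sqrr_sign. Qed.

Lemma card_ltU (i l : 'I_n) J : i \notin J ->
  #|[pred j in i |: J | (j < l)%N]| = ((i < l) + #|[pred j in J | (j < l)%N]|)%N.
Proof.
move=> iJ; rewrite (cardD1 i) !inE eqxx /=; congr (_ + _)%N.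
by apply: eq_card => j; rewrite !inE; case: eqP => //= ->; rewrite (negbTE iJ).
Qed.

(** This is [dx_i /\ dx_l = - dx_l /\ dx_i]: exactly one of [i < l] and [l < i] holds, so the two
    exponents differ in parity. *)
Lemma wedge_signC i l J : i \notin J -> l \in J ->
  wedge_sign A i (i |: J) * wedge_sign A l (i |: J) =
  - (wedge_sign A l J * wedge_sign A i (i |: J :\ l)).
Proof.
move=> iJ lJ; rewrite /wedge_sign -!exprD.
have lJl : l \notin J :\ l by rewrite !inE eqxx.
have iJl : i \notin J :\ l by rewrite !inE (negbTE iJ) andbF.
rewrite !card_ltU // ltnn -{1}(finset.setD1K lJ) card_ltU //.
rewrite -[RHS]mulN1r -exprS.
have : i != l by apply: contraNneq iJ => ->.
rewrite -(inj_eq val_inj) /= => il.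
move: #|_| #|_| => p q.
rewrite -[LHS]signr_odd -[RHS]signr_odd; congr (_ ^+ nat_of_bool _).
rewrite /= !oddD !oddb; case: ltngtP il => //= _ _;
  case: (odd p) (odd q) => -[] //.
Qed.

Lemma kform_eq k (v w : kform A n k) :
  (forall J, #|J| = k -> form_coef v J = form_coef w J) -> v = w.
Proof.
by move=> vw; apply/ffunP => J; rewrite -!form_coef_val vw // (eqP (valP J)).
Qed.

(** Contraction is an antiderivation for the wedge product. *)
Lemma contract_wedge1 i k a (w : kform A n k.+1) :
  contract i (wedge1 a w) + wedge1 a (contract i w) = a i *: w.
Proof.
apply: kform_eq => J Jk; rewrite form_coefD form_coefZ form_coef_wedge1.
have [iJ|iJ] := boolP (i \in J).
  rewrite form_coef_contract0 // add0r (bigD1 i) //= form_coef_contract; last first.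
    by rewrite finset.setD11.
  rewrite finset.setD1K // big1 ?addr0 => [|l /andP[lJ li]]; last first.
    by rewrite form_coef_contract0 ?mulr0 // !inE eq_sym li iJ.
  by rewrite mulrCA (mulrA (wedge_sign A i J)) wedge_signK mul1r.
(* The index [l = i] gives [a i *: w]; by [wedge_signC] the others cancel against the second
   summand. *)
rewrite form_coef_contract // form_coef_wedge1 big_setU1 //= finset.setU1K //.
rewrite mulrDr mulrA wedge_signK mul1r -addrA mulr_sumr -big_split big1 ?addr0 //.
move=> l lJ /=; have il : i != l by apply: contraNneq iJ => ->.
rewrite form_coef_contract; last by rewrite !inE (negbTE iJ) andbF.
have -> : (i |: J) :\ l = i |: J :\ l.
  by apply/finset.setP => j; rewrite !inE; case: (eqVneq j i) => //= ->; rewrite il.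
by rewrite mulrA wedge_signC //; ring.
Qed.

Lemma contract_wedge1_0 i a (w : kform A n 0) :
  contract i (wedge1 a w) = a i *: w.
Proof.
apply: kform_eq => J /cards0_eq->; rewrite form_coefZ form_coef_contract ?inE //.
rewrite form_coef_wedge1 finset.setU0 big_set1 finset.setDv mulrA wedge_signK.
by rewrite mul1r.
Qed.

Lemma contractZ i k b (w : kform A n k.+1) :
  contract i (b *: w) = b *: contract i w.
Proof.
by apply/ffunP => J; rewrite !ffunE form_coefZ /GRing.scale /= mulrCA.
Qed.

Lemma contract_eq0 k (w : kform A n k.+1) : (forall i, contract i w = 0) -> w = 0.
Proof.
move=> w0; apply/ffunP => J; rewrite ffunE -form_coef_val.
have /card_gt0P[i iJ] : (0 < #|val J|)%N by rewrite (eqP (valP J)).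
have := form_coef_contract w (J := val J :\ i) (i := i).
rewrite finset.setD11 => /(_ isT).
rewrite w0 finset.setD1K // => /(congr1 ( *%R (wedge_sign A i (val J)))).
rewrite mulrA wedge_signK mul1r => <-.
by rewrite /form_coef; case: insub => [I|]; rewrite ?ffunE mulr0.
Qed.

Lemma wedge1_0 k a : wedge1 a (0 : kform A n k) = 0.
Proof. by rewrite -[X in wedge1 a X](scale0r 0) wedge1Z scale0r. Qed.

(** It suffices that all contractions vanish. Applying [contract_wedge1] twice turns each one into
    [a /\ a /\ contract i w], of lower degree. *)
Lemma wedge1_wedge1 k a (w : kform A n k) : wedge1 a (wedge1 a w) = 0.
Proof.
elim: k w => [|k IH] w; apply: contract_eq0 => i.
  rewrite -[LHS]addr0 -(subrr (wedge1 a (contract i (wedge1 a w)))) addrA.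
  by rewrite contract_wedge1 contract_wedge1_0 wedge1Z subrr.
apply: (addIr (wedge1 a (contract i (wedge1 a w)))).
rewrite contract_wedge1 add0r -wedge1Z -(contract_wedge1 i) wedge1D IH addr0 //.
Qed.

End Contraction.

(** * Inversion of convergent power series *)

Section Units.
Variables (C : numClosedFieldType) (n : nat).
Implicit Types (f g : 'X_{1..n} -> C) (u v w : cps C n) (m : 'X_{1..n}).

Definition l1_trunc (r : C) d f := \sum_(m : 'X_{1..n < d}) `|f m| * r ^+ mdeg m.

Lemma l1_trunc_ge0 r d f : 0 <= r -> 0 <= l1_trunc r d f.
Proof. by move=> r0; apply: sumr_ge0 => m _; rewrite mulr_ge0 ?exprn_ge0. Qed.

Lemma l1_truncM r d f g : 0 <= r ->
  l1_trunc r d (ps_mul f g) <= l1_trunc r d f * l1_trunc r d g.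
Proof.
move=> r0; pose F (f' : 'X_{1..n} -> C) m := `|f' m| * r ^+ mdeg m.
rewrite /l1_trunc big_distrlr pair_big /=.
apply: (@le_trans _ _ (\sum_(m : 'X_{1..n < d})
    \sum_(k : 'X_{1..n < d, d} | bmnm m == (k.1 + k.2)%MM) F f k.1 * F g k.2)).
  apply: ler_sum => m _; rewrite (ps_mulEw f g (bmdeg m)).
  apply: le_trans (ler_wpM2r _ (ler_norm_sum _ _ _)) _; first by rewrite exprn_ge0.
  rewrite mulr_suml; apply: ler_sum => k /eqP ->.
  by rewrite mdegD exprD normrM /F mulrACA.
rewrite (exchange_big_dep xpredT) //=; apply: ler_sum => k _.
(* A pair [k] is counted once for each [m] equal to [k.1 + k.2], hence at most once. *)
rewrite sumr_const -mulr_natr; apply: ler_piMr.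
  by rewrite !mulr_ge0 ?exprn_ge0.
rewrite lern1; apply/card_le1_eqP => m m' /eqP mE /eqP m'E.
by do 3!apply: val_inj; exact: etrans m'E (esym mE).
Qed.

Lemma cps_sumE I (r : seq I) (P : pred I) (F : I -> cps C n) m :
  (\sum_(i <- r | P i) F i) m = \sum_(i <- r | P i) F i m.
Proof. exact: (big_morph (fun u => u m)). Qed.

Lemma cps_expr_low w j m : w 0%MM = 0 -> (mdeg m < j)%N -> (w ^+ j) m = 0.
Proof.
move=> w0; elim: j m => // j IH m mj; rewrite exprS /= /ps_mul.
rewrite big1 // => k /eqP mE.
have [kj|jk] := ltnP (mdeg k.2) j; first by rewrite IH ?mulr0.
suff /eqP -> : bmnm k.1 == 0%MM by rewrite w0 mul0r.
rewrite -mdeg_eq0 -leqn0 -(leq_add2r j) add0n -ltnS; apply: leq_ltn_trans mj.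
by rewrite [leqRHS](congr1 (@mdeg n) mE) mdegD leq_add2l.
Qed.

(** The geometric series in [w]. If [w] has no constant term, powers above [mdeg m] do not reach the
    coefficient of [m], so finite sums suffice. *)
Definition geom w m : C := (\sum_(j < (mdeg m).+1) w ^+ j) m.

Lemma geomE w m d : w 0%MM = 0 -> (mdeg m < d)%N ->
  geom w m = (\sum_(j < d) w ^+ j) m.
Proof.
move=> w0 md; rewrite /geom !cps_sumE -!(big_mkord xpredT (fun j => (w ^+ j) m)).
rewrite [RHS](@big_cat_nat _ _ _ (mdeg m).+1) //= [X in _ + X]big_nat_cond.
by rewrite [X in _ + X]big1 ?addr0 // => j /andP[/andP[mj _] _];
  rewrite cps_expr_low.
Qed.

Lemma geomK w m : w 0%MM = 0 ->
  ps_mul (1 - w : cps C n) (geom w) m = (1 : cps C n) m.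
Proof.
move=> w0; transitivity (((1 - w) * \sum_(j < (mdeg m).+1) w ^+ j) m).
  by apply: eq_bigr => k _; rewrite (geomE w0 (bmdeg k.2)).
by rewrite -[1 - w]opprB mulNr -subrX1 opprB /= cps_expr_low // subr0.
Qed.

(** On a small polydisc [w] has weighted l1-norm at most 1/2; submultiplicativity bounds that of
    [w ^+ j] by [2^-1 ^+ j], and these sum to at most 2. *)
Lemma convergent_geom w : w 0%MM = 0 -> convergent (geom w).
Proof.
move=> w0; have [r [M [r0 wM]]] := cpsP w.
have M0 : 0 <= M by apply: le_trans (wM 0%N); apply/l1_trunc_ge0/ltW.
(* Shrinking the radius by [e] scales every nonconstant term by at most [e], and [e * M <= 1/2]; the
   [+ 1] covers [M = 0]. *)
pose e := (2 * (M + 1))^-1.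
have M1 : 0 < 2 * (M + 1) by rewrite mulr_gt0 // ltr_wpDl.
have e0 : 0 < e by rewrite invr_gt0.
have e1 : e <= 1 by rewrite invf_le1 // mulrDr mulr1 ler_wpDl ?ler1n // mulr_ge0.
have r'0 : 0 <= e * r by rewrite mulr_ge0 ?ltW.
have half d : l1_trunc (e * r) d w <= 2^-1.
  apply: (@le_trans _ _ (e * M)); last first.
    by rewrite mulrC ler_pdivrMr // mulrA mulVf ?mul1r ?pnatr_eq0 // lerDl.
  apply: le_trans (ler_wpM2l (ltW e0) (wM d)); rewrite mulr_sumr.
  apply: ler_sum => m _; have [->|m0] := eqVneq (bmnm m) 0%MM.
    by rewrite w0 normr0 !mul0r mulr0.
  rewrite mulrCA ler_wpM2l // exprMn ler_wpM2r ?exprn_ge0 ?(ltW r0) //.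
  by rewrite -[leRHS]expr1 ler_wiXn2l ?(ltW e0) // lt0n mdeg_eq0.
have expr_half j d : l1_trunc (e * r) d (w ^+ j : cps C n) <= 2^-1 ^+ j.
  elim: j => [|j IH].
    rewrite expr0 /l1_trunc; case: d => [|d].
      by rewrite big_pred0 // => -[m]; rewrite ltn0.
    have z0 : (mdeg (0%MM : 'X_{1..n}) < d.+1)%N by rewrite mdeg0.
    rewrite (bigD1 (BMultinom z0)) //= eqxx normr1 mul1r mdeg0 big1 ?addr0 // => m.
    by rewrite bmeqP /= => /negbTE ->; rewrite normr0 mul0r.
  rewrite !exprS; apply: le_trans (l1_truncM _ _ _ r'0) _.
  by apply: ler_pM; rewrite ?l1_trunc_ge0.
exists (e * r), 2; split=> [|d]; first by rewrite mulr_gt0.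
apply: (@le_trans _ _ (\sum_(j < d) l1_trunc (e * r) d (w ^+ j : cps C n))).
  rewrite exchange_big /=; apply: ler_sum => m _; rewrite -mulr_suml.
  rewrite (geomE w0 (bmdeg m)) cps_sumE ler_wpM2r ?exprn_ge0 //.
  exact: ler_norm_sum.
apply: (@le_trans _ _ (\sum_(j < d) 2^-1 ^+ j)).
  by apply: ler_sum => j _; exact: expr_half.
suff -> : \sum_(j < d) 2^-1 ^+ j = 2 - 2 * 2^-1 ^+ d :> C.
  by rewrite gerBl mulr_ge0 ?exprn_ge0 ?invr_ge0.
elim: d => [|d IH]; first by rewrite big_ord0 expr0 mulr1 subrr.
by rewrite big_ord_recr /= IH exprS; field.
Qed.

Lemma convergentZ (c : C) f : convergent f -> convergent (fun m => c * f m).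
Proof.
move=> [r [M [r0 fM]]]; exists r, (`|c| * M); split=> // d.
apply: le_trans (ler_wpM2l (normr_ge0 c) (fM d)); rewrite mulr_sumr.
by apply: ler_sum => m _; rewrite normrM mulrA.
Qed.

(** Divided by its constant term, [u] becomes [1 - w] with [w] vanishing at 0, and [geom w] inverts
    it. *)
Lemma cps_unit_coef0 u : u 0%MM != 0 -> exists v, v * u = 1.
Proof.
move=> u0; pose c := (u 0%MM)^-1.
pose w : cps C n := 1 - mk_cps (convergentZ c (cpsP u)).
have w0 : w 0%MM = 0 by rewrite /= eqxx mulVf // subrr.
exists (mk_cps (convergentZ c (convergent_geom w0))).
apply/cps_eqP => m; rewrite -(geomK _ w0) mulrC /= /ps_mul.
by apply: eq_bigr => k _; rewrite /= opprB addrC subrK mulrA [u _ * c]mulrC.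
Qed.

End Units.

(** * Nonvanishing of polynomials at natural points, and Euler's identity *)

Lemma digits_inj n N (a b : 'I_n -> nat) :
  (forall i, a i < N)%N -> (forall i, b i < N)%N ->
  (\sum_i a i * N ^ i = \sum_i b i * N ^ i)%N -> a =1 b.
Proof.
elim: n a b => [|n IH] a b aN bN; first by move=> _ [].
have shift (a' : 'I_n.+1 -> nat) : (\sum_i a' i * N ^ i =
    (\sum_(i < n) a' (fintype.lift ord0 i) * N ^ i) * N + a' ord0)%N.
  rewrite big_ord_recl muln1 addnC big_distrl; congr (_ + _)%N.
  by apply: eq_bigr => i _; rewrite /= -mulnA expnSr.
rewrite !shift => ab.
have N0 : (0 < N)%N by apply: leq_trans (aN ord0).
have ab0 : a ord0 = b ord0.
  by have := congr1 (modn^~ N) ab; rewrite !modnMDl !modn_small.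
move: ab; rewrite ab0 => /addIn/eqP; rewrite eqn_pmul2r // => /eqP ab i.
case: (unliftP ord0 i) => [j|] -> //.
exact: (IH (a \o fintype.lift ord0) (b \o fintype.lift ord0)
  (fun=> aN _) (fun=> bN _) ab j).
Qed.

(* Kronecker substitution: the powers of [t] with exponents [\sum_i m i * N ^ i]
   separate the monomials, so a univariate polynomial in [t] remains. *)
Lemma mpoly_nat_nonroot (K : numDomainType) n (p : {mpoly K[n]}) : p != 0 ->
  exists c : 'I_n -> nat, p.@[fun i => (c i)%:R] != 0.
Proof.
move=> p0; pose N := msize p.
pose wt (m : 'X_{1..n}) := (\sum_i m i * N ^ i)%N.
pose P : {poly K} := \sum_(m <- msupp p) p@_m *: 'X^(wt m).
have mN m : m \in msupp p -> forall i, (m i < N)%N.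
  move=> mp i; apply: leq_ltn_trans (msize_mdeg_lt mp).
  by rewrite mdegE (bigD1 i) ?leq_addr.
have P0 : P != 0.
  have m0p : mlead p \in msupp p by rewrite mlead_supp.
  apply/eqP => /(congr1 (fun q : {poly K} => q`_(wt (mlead p)))).
  rewrite coef0 coef_sum (bigD1_seq (mlead p)) ?msupp_uniq //=.
  rewrite coefZ coefXn eqxx mulr1 big_seq_cond big1 ?addr0.
    by move/eqP; rewrite mcoeff_eq0 m0p.
  move=> m /andP[mp mm0]; rewrite coefZ coefXn.
  case: eqP => [/digits_inj e|_]; last by rewrite mulr0.
  by case/eqP: mm0; apply/mnmP => i; apply/esym/e; apply: mN.
have [t Pt] : exists t : nat, P.[t%:R] != 0.
  (* Otherwise [0, ..., size P - 1] would be [size P] distinct roots of [P]. *)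
  apply: contrapT => nt.
  have /(max_poly_roots P0) : all (root P) [seq i%:R | i <- iota 0 (size P)].
    apply/allP => _ /mapP[i _ ->]; apply/eqP; apply: contrapT => Pi.
    by apply: nt; exists i; apply/eqP.
  rewrite map_inj_uniq ?iota_uniq; last by move=> i j /eqP; rewrite eqr_nat => /eqP.
  by move=> /(_ isT); rewrite size_map size_iota ltnn.
exists (fun i => (t ^ (N ^ i))%N); apply: contra_neq Pt => <-.
rewrite mevalE horner_sum; apply: eq_bigr => m _.
rewrite hornerZ hornerXn; congr (_ * _); rewrite -prodrXr.
by apply: eq_bigr => i _; rewrite natrX -exprM mulnC.
Qed.

(** On a monomial [m], the operator [c_i d/dx_i] multiplies the value at [c] by [m i], and the [m i]
    add up to [d]. *)
Lemma euler_homog (K : comNzRingType) n d (p : {mpoly K[n]}) (c : 'I_n -> K) :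
  p \is d.-homog -> \sum_i c i * (p^`M(i)).@[c] = d%:R * p.@[c].
Proof.
move=> /dhomogP pd; rewrite [in RHS]mevalE mulr_sumr /mderiv.
under eq_bigr => i _ do rewrite raddf_sum mulr_sumr.
rewrite exchange_big !big_seq; apply: eq_bigr => m /pd <- /=.
rewrite {1}mdegE natr_sum mulr_suml; apply: eq_bigr => i _; rewrite mevalZ.
(* For [m i = 0] the truncated subtraction [m - U_(i)] is not inverted by adding [U_(i)], but the
   factor [m i] kills the term. *)
have [->|mi0] := eqVneq (m i) 0%N; first by rewrite !mul0r mulr0.
rewrite -mulrA mulrCA; congr (_ * _); rewrite mulrCA; congr (_ * _).
rewrite -mevalX -[in RHS](@submK _ U_(i)%MM m) ?lep1mP //.
by rewrite mpolyXD mevalM mevalXU mulrC.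
Qed.

(** * Directional derivatives of power series *)

Section DirectionalDerivative.
Variables (C : numClosedFieldType) (n : nat) (c : 'I_n -> nat).
Implicit Types (f : 'X_{1..n} -> C) (u v : cps C n).

(* Natural coordinates avoid having to embed [C] into [cps C n]. *)
Definition dir_deriv u : cps C n := \sum_i cps_deriv i u *+ c i.

Lemma dir_derivM u v : dir_deriv (u * v) = dir_deriv u * v + u * dir_deriv v.
Proof.
rewrite /dir_deriv mulr_suml mulr_sumr -big_split; apply: eq_bigr => i _ /=.
by rewrite cps_derivM mulrnDl mulrnAl mulrnAr.
Qed.

Definition hpart d f : {mpoly C[n]} :=
  ps_trunc d.+1 (fun m => f m *+ (mdeg m == d)).

Lemma mcoeff_hpart d f m : (hpart d f)@_m = f m *+ (mdeg m == d).
Proof.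
have [md|dm] := ltnP (mdeg m) d.+1; first by rewrite mcoeff_mpoly.
rewrite gtn_eqF // mulr0n raddf_sum big1 // => k _ /=; rewrite mcoeffZ mcoeffX.
case: (bmnm k =P m) dm => [<-|]; rewrite ?mulr0 //.
by rewrite ltnNge (bmdeg k : (mdeg k <= d)%N).
Qed.

Lemma hpart_deriv d i f : hpart d (ps_deriv i f) = (hpart d.+1 f)^`M(i).
Proof.
apply/mpolyP => m; rewrite mcoeff_deriv !mcoeff_hpart mdegD mdeg1 addn1 eqSS.
by rewrite /ps_deriv mulr_natl mulrnAC.
Qed.

(* The coefficient of [t ^ d] in the restriction of [f] to the line [t * c]. *)
Definition line_coef d f : C := (hpart d f).@[fun i => (c i)%:R].

Lemma line_coef0 f : line_coef 0 f = f 0%MM.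
Proof.
rewrite /line_coef; suff -> : hpart 0 f = (f 0%MM)%:MP by rewrite mevalC.
apply/mpolyP => m; rewrite mcoeff_hpart mcoeffC mdeg_eq0 eq_sym.
by case: eqP => [->|_]; rewrite ?mulr1 ?mulr0.
Qed.

(** The derivative of [u] along [c], restricted to the line, is the [t]-derivative of the
    restriction of [u]; in degree [d] this is Euler's identity for [hpart d.+1 u]. *)
Lemma line_coef_dir d u :
  line_coef d (dir_deriv u) = d.+1%:R * line_coef d.+1 u.
Proof.
transitivity (\sum_i (c i)%:R * ((hpart d.+1 u)^`M(i)).@[fun i => (c i)%:R] : C).
  rewrite /line_coef.
  suff -> : hpart d (dir_deriv u) = \sum_i (c i)%:R *: (hpart d.+1 u)^`M(i).
    by rewrite raddf_sum; apply: eq_bigr => i _; rewrite /= mevalZ.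
  apply/mpolyP => m; rewrite mcoeff_hpart raddf_sum /= cps_sumE -sumrMnl.
  apply: eq_bigr => i _; rewrite mcoeffZ -hpart_deriv mcoeff_hpart mulr_natl.
  rewrite mulrnAC; congr (_ *+ _).
  by elim: (c i) => // k IH; rewrite !mulrS -IH.
apply: euler_homog; apply/dhomogP => m.
by rewrite mcoeff_msupp mcoeff_hpart; case: (mdeg m =P _) => //; rewrite eqxx.
Qed.

(** The constant term of the [d]-th derivative is [d!] times [line_coef d u], and the characteristic
    is 0. *)
Lemma dir_deriv_iter d u :
  line_coef d u != 0 -> (iter d dir_deriv u) 0%MM != 0.
Proof.
elim: d u => [|d IH] u; first by rewrite line_coef0.
by move=> ud; rewrite iterSr IH // line_coef_dir mulf_neq0 // pnatr_eq0.
Qed.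

End DirectionalDerivative.

(** * A derivative of a reduced equation that is a non-zero-divisor *)

Section Nonzerodivisor.
Variables (C : numClosedFieldType) (n : nat).
Implicit Types (h u v : cps C n).

Lemma dir_deriv_unit h : h != 0 ->
  exists c : 'I_n -> nat, exists d v, v * iter d (dir_deriv c) h = 1.
Proof.
move=> /cps_lead[m hm _].
have hd : hpart (mdeg m) h != 0.
  apply: contra_neq hm => /(congr1 (mcoeff m)).
  by rewrite mcoeff_hpart eqxx mcoeff0.
have [c hc] := mpoly_nat_nonroot hd; exists c, (mdeg m).
exact/cps_unit_coef0/dir_deriv_iter.
Qed.

Lemma principal_idealM h u v :
  u \in principal_ideal h -> v * u \in principal_ideal h.
Proof. exact: (rpredZ v). Qed.

Lemma dir_deriv_nonzerodivisor h : reduced_germ h ->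
  exists c : 'I_n -> nat, forall u,
    u * dir_deriv c h \in principal_ideal h -> u \in principal_ideal h.
Proof.
move=> [h0 hred]; have [c [d [e eD]]] := dir_deriv_unit h0.
exists c => u /asboolP[s uDh]; pose D := @dir_deriv C n c.
(* By reducedness it is enough that [h] divides the square of [u * D v]. One factor is expanded by
   differentiating [u * v = w * h]; the other supplies the [u] needed in [u * D h] and [u * v]. *)
have stable v : u * v \in principal_ideal h -> u * D v \in principal_ideal h.
  move=> /asboolP[w uv]; apply: (hred _ 2%N); apply/asboolP.
  exists ((u * D w + w * s - w * D u) * D v).
  have uDv : u * D v = D w * h + w * D h - D u * v.
    by apply: (addrI (D u * v)); rewrite -dir_derivM uv dir_derivM [RHS]addrC subrK.
  transitivity ((u * D w * h + w * (u * D h) - D u * (u * v)) * D v).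
    by rewrite expr2 {1}uDv; ring.
  by rewrite uDh uv; ring.
suff : u * iter d D h \in principal_ideal h.
  by move/(principal_idealM e); rewrite mulrCA eD mulr1.
elim: d {eD} => [|d IH]; last exact: stable.
by apply: principal_idealM; apply/asboolP; exists 1; rewrite mul1r.
Qed.

End Nonzerodivisor.

(** * Quotients of quotient modules *)

Lemma quotproj_eq0 (A : pzRingType) (M : lmodType A) (N : submodClosed M) a :
  quotproj N a = 0 <-> a \in N.
Proof.
rewrite -[0](linear0 (quotproj N)); split=> [/quotproj_eq|aN].
  by rewrite subr0.
by apply/quotproj_eq; rewrite subr0.
Qed.

(** Third isomorphism theorem, with [T] in the role of [P / N]; the inclusion of [N] in [P] follows
    from the hypothesis, as [T] contains 0. *)
Lemma quotmod_quot_iso (A : pzRingType) (M : lmodType A) (N P : submodClosed M)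
    (T : submodClosed (quotmod N)) :
  (forall a, (quotproj N a \in T) <-> (a \in P)) ->
  exists f : {linear quotmod P -> quotmod T},
    bijective f /\ forall a, f (quotproj P a) = quotproj T (quotproj N a).
Proof.
move=> memT; pose f (x : quotmod P) : quotmod T :=
  quotproj T (quotproj N (repr (x : Quotient.quot (submod_pred P)))).
have f_eq a b : quotproj T (quotproj N a) = quotproj T (quotproj N b) <->
    quotproj P a = quotproj P b.
  split=> [/quotproj_eq|/quotproj_eq]; rewrite -?linearB => /memT ab;
    by apply/quotproj_eq; rewrite -?linearB.
have fE a : f (quotproj P a) = quotproj T (quotproj N a).
  by apply/f_eq; exact: quotprojK.
have f_linear : linear f.
  move=> b x y; rewrite -[x]quotprojK -[y]quotprojK -linearP !fE.
  by rewrite !linearP.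
pose F : {linear quotmod P -> quotmod T} :=
  HB.pack f (GRing.isLinear.Build _ _ _ _ f f_linear).
exists F; split=> //.
pose g (y : quotmod T) : quotmod P :=
  let z : quotmod N := repr (y : Quotient.quot (submod_pred T)) in
  quotproj P (repr (z : Quotient.quot (submod_pred N))).
have gK : cancel g f by move=> y; rewrite fE !quotprojK.
have f_inj : injective f.
  by move=> x y; rewrite -[x]quotprojK -[y]quotprojK !fE => /f_eq.
by exists g => // x; apply: f_inj; rewrite gK.
Qed.

(** * Logarithmic forms and torsion of Kähler forms *)

Section LogarithmicForms.
Variables (C : numClosedFieldType) (n : nat).
Local Notation O := (cps C n).
Local Notation F := (@FracField.tofrac O).
Implicit Types (h g : O) (k : nat).

Lemma mero_inj k : injective (@mero C n k).
Proof.
move=> a b /ffunP ab; apply/ffunP => I; have := ab I; rewrite !ffunE => /eqP.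
by rewrite tofrac_eq => /eqP.
Qed.

Lemma mero_d_mero k (a : kform O n k) :
  mero_d (mero a) = mero (ext_deriv (@cps_deriv C n) a).
Proof.
apply/ffunP => J; rewrite !ffunE rmorph_sum; apply: eq_bigr => i _ /=.
rewrite tofracM rmorphXn rmorphN1; congr (_ * _).
rewrite -(frac_deriv_tofrac (@cps_derivM C n i)); congr frac_deriv.
by rewrite /form_coef; case: insubP => [I _ _|_]; rewrite ?ffunE // tofrac0.
Qed.

(* [d(h w) = dh /\ w + h dw], so that [h dw] is regular if and only if
   [dh /\ w] is. *)
Lemma hlog_formsP h k (a : kform O n k) : h != 0 ->
  (a \in hlog_forms h k) <-> (exists e, wedge1 (dfun h) a = h *: e).
Proof.
move=> h0; have Fh0 : F h != 0 by rewrite tofrac_eq0.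
have dE w : mero a = F h *: w ->
    mero (ext_deriv (@cps_deriv C n) a) =
    wedge1 (fun i => F (dfun h i)) w + F h *: mero_d w.
  move=> aw; rewrite -mero_d_mero aw /mero_d (ext_derivZ _ _ (@frac_cps_derivM C n)).
  congr (wedge1 _ _ + _); apply/funext => i.
  by rewrite (frac_deriv_tofrac (@cps_derivM C n i)).
have wE w : mero a = F h *: w ->
    mero (wedge1 (dfun h) a) = F h *: wedge1 (fun i => F (dfun h i)) w.
  by move=> aw; rewrite mero_wedge1 aw wedge1Z.
split=> [/asboolP[w [_ [b hdw]] aw]|[e he]].
  (* Here [b] is [h dw], so [da - b] is [dh /\ w], the quotient of [dh /\ a] by [h]. *)
  exists (ext_deriv (@cps_deriv C n) a - b); apply: mero_inj.
  rewrite (wE _ aw) meroZ; congr (_ *: _).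
  apply: (addIr (mero b)); rewrite -meroD subrK (dE _ aw) hdw //.
pose w : kform {fraction O} n k := (F h)^-1 *: mero a.
have aw : mero a = F h *: w by rewrite /w scalerA divff // scale1r.
apply/asboolP; exists w => //; split; first by exists a.
exists (ext_deriv (@cps_deriv C n) a - e).
apply: (addrI (wedge1 (fun i => F (dfun h i)) w)); rewrite -(dE _ aw).
suff -> : wedge1 (fun i => F (dfun h i)) w = mero e by rewrite -meroD addrC subrK.
apply: (scalerI Fh0); rewrite -(wE _ aw) he meroZ //.
Qed.

Lemma dh_wedge_wedge1 h k (a : kform O n k) :
  dh_wedge h a -> wedge1 (dfun h) a = 0.
Proof. by case: k a => [|k] a /= => [->|[b ->]]; rewrite ?wedge1_0 ?wedge1_wedge1. Qed.

Lemma kahler_rel_hlog h k : h != 0 -> {subset kahler_rel h k <= hlog_forms h k}.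
Proof.
move=> h0 a /asboolP[b [c [dc ->]]]; apply/(hlog_formsP _ h0).
by exists (wedge1 (dfun h) b); rewrite wedge1D wedge1Z (dh_wedge_wedge1 dc) addr0.
Qed.

(** Contracting [dh /\ a = h e] gives [dh/dx_i a = h (contract i e) + dh /\ contract i a], without
    the last term in degree 0. *)
Lemma partial_hlog_forms h k (a : kform O n k) i : h != 0 ->
  a \in hlog_forms h k -> cps_deriv i h *: a \in kahler_rel h k.
Proof.
move=> h0 /(hlog_formsP _ h0)[e he]; apply/asboolP.
case: k a e he => [|k] a e he.
  exists (contract i e), 0; split=> //.
  by rewrite addr0 -contractZ -he contract_wedge1_0.
exists (contract i e), (wedge1 (dfun h) (contract i a)); split.
  by exists (contract i a).
by rewrite -contractZ -he contract_wedge1.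
Qed.

Lemma dir_deriv_hlog_forms h k (a : kform O n k) c : h != 0 ->
  a \in hlog_forms h k -> dir_deriv c h *: a \in kahler_rel h k.
Proof.
move=> h0 ah; rewrite scaler_suml rpred_sum // => i _.
by rewrite -scalerMnl rpredMn // partial_hlog_forms.
Qed.

Lemma nonzerodivisorP h g :
  nonzerodivisor h g <->
  (forall u, u * g \in principal_ideal h -> u \in principal_ideal h).
Proof.
split=> [nz u ug|nz y].
  apply/quotproj_eq0/nz; rewrite -linearZ; apply/quotproj_eq0.
  by rewrite /GRing.scale /= mulrC.
rewrite -[y]quotprojK -linearZ => /quotproj_eq0 yg; apply/quotproj_eq0/nz.
by rewrite mulrC.
Qed.

Lemma kahler_rel_nonzerodivisor h g k (a : kform O n k) : h != 0 ->
  nonzerodivisor h g -> g *: a \in kahler_rel h k -> a \in hlog_forms h k.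
Proof.
move=> h0 /nonzerodivisorP nz /(kahler_rel_hlog h0) /(hlog_formsP _ h0)[e he].
apply/(hlog_formsP _ h0).
(* The factor [g] is cancelled modulo [h] in each coefficient separately. *)
have /choice[b bP] : forall J, exists b, wedge1 (dfun h) a J = b * h.
  move=> J; apply/asboolP/nz/asboolP; exists (e J).
  move: he => /ffunP/(_ J); rewrite wedge1Z [in RHS]ffunE [in LHS]ffunE.
  by rewrite /GRing.scale /= mulrC => ->; rewrite mulrC.
by exists [ffun J => b J]; apply/ffunP => J; rewrite bP !ffunE /GRing.scale /= mulrC.
Qed.

Lemma torsion_Omega_D h k (a : kform O n k) : reduced_germ h ->
  (quotproj (kahler_rel h k) a \in torsion h (Omega_D h k)) <->
  (a \in hlog_forms h k).
Proof.
move=> hr; have h0 := hr.1.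
split=> [/asboolP[g nz]|ah].
  by rewrite -linearZ => /quotproj_eq0; exact: kahler_rel_nonzerodivisor.
(* The annihilator [dir_deriv c h] depends on [h] alone and serves all [a] at once. *)
have [c nz] := dir_deriv_nonzerodivisor hr.
apply/asboolP; exists (dir_deriv c h); first exact/nonzerodivisorP.
by rewrite -linearZ; apply/quotproj_eq0/dir_deriv_hlog_forms.
Qed.

End LogarithmicForms.

Theorem corollary3p4 (R : realType) (n : nat) (V : complex_manifold R n)
    (D : set V) (freeD : free_divisor D)
    (U : set V) (h : V -> R[i]) (hU : reduced_equation D U h)
    (x : V) (Ux : U x) (phi : chart R n V) (phix : chart_at phi x)
    (k : nat) (kn : (k <= n)%N) :
  let hx := germ_in phi h x in
  {subset kahler_rel hx k <= hlog_forms hx k} /\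
  (forall w : Omega_D hx k,
     w \in torsion hx (Omega_D hx k) <->
     exists2 a, a \in hlog_forms hx k & w = quotproj (kahler_rel hx k) a) /\
  (exists f : {linear Omega_check hx k -> quotmod (torsion hx (Omega_D hx k))},
     bijective f /\
     forall a, f (quotproj (hlog_forms hx k) a) =
       quotproj (torsion hx (Omega_D hx k)) (quotproj (kahler_rel hx k) a)).
Proof.
have [_ _ _ /(_ x Ux phi phix) hr] := hU.
move: (germ_in phi h x) hr => hx hr /=.
split; first exact: kahler_rel_hlog hr.1.
split=> [w|].
  split=> [|[a ah ->]]; last exact/torsion_Omega_D.
  rewrite -[w]quotprojK => /(torsion_Omega_D _ hr) wh.
  by eexists; first exact: wh.
by apply: quotmod_quot_iso => a; apply: torsion_Omega_D.
Qed.
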